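(* For integers $d>m\ge 1$, $f_{\triangle}(d,m)=dm$.
   Context: All graphs are finite, simple and undirected. A graph is triangle-free if it has no three pairwise adjacent vertices. $\Delta(G)$ is the maximum degree and $\nu(G)$ the matching number of $G$. For positive integers $d,m$, $f_{\triangle}(d,m)$ is the maximum number of edges of a triangle-free graph $G$ with $\Delta(G)\le d$ and $\nu(G)\le m$. *)

(* Defs.v *)
From HB Require Import structures.
From mathcomp Require Import all_boot.

Set Implicit Arguments.
Unset Strict Implicit.
Unset Printing Implicit Defensive.

Record sgraph := SGraph {
  vertex : finType;
  adj : rel vertex;
  adj_sym : symmetric adj;
  adj_irrefl : irreflexive adj
}.

Definition triangle_free (G : sgraph) : Prop :=
  forall x y z : vertex G, ~ [/\ adj x y, adj y z & adj x z].

Definition degree (G : sgraph) (x : vertex G) : nat :=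
  #|[set y | adj x y]|.

Definition max_degree (G : sgraph) : nat :=
  \max_(x : vertex G) degree x.

(* Edges are unordered pairs, so each edge is counted once. *)
Definition edges (G : sgraph) : {set {set vertex G}} :=
  [set [set p.1; p.2] | p in [pred p : vertex G * vertex G | adj p.1 p.2]].

Definition matching (G : sgraph) (M : {set {set vertex G}}) : bool :=
  (M \subset edges G) && trivIset M.

Definition matching_number (G : sgraph) : nat :=
  \max_(M : {set {set vertex G}} | matching M) #|M|.

Definition is_maximum (S : nat -> Prop) (k : nat) : Prop :=
  S k /\ forall j, S j -> j <= k.

(* [f_triangle_eq d m k] states that the maximum defining f_triangle(d, m)
   exists and equals k; a relation is used because the maximum ranges over
   graphs with any number of vertices. *)
Definition f_triangle_eq (d m k : nat) : Prop :=
  is_maximum (fun j => exists G : sgraph,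
    [/\ triangle_free G, max_degree G <= d, matching_number G <= m
      & #|edges G| = j]) k.

(* Main.v *)
Require Import Defs.
From mathcomp Require Import all_boot.
From mathcomp Require Import zify.

(** Upper bound, by induction on [m].  If some vertex is covered by every
    maximum matching, deleting its (at most [d]) edges lowers the matching
    number.  Otherwise, as in Gallai's lemma, "no maximum matching misses both
    [x] and [y]" is a transitive relation containing adjacency.  Fix a maximum
    matching and one of its edges [xy].  By triangle-freeness the neighbourhoods
    of [x] and [y] are disjoint, and at most one vertex of their union is
    missed, so [deg x + deg y <= 2m + 1] and at most one edge joins [x] or [y]
    to a missed vertex.  Missed vertices are pairwise non-adjacent, so summing
    over the matching edges bounds the degree sum by [m (2m + 2) <= 2dm].
    Equality is attained by [m] disjoint stars with [d] leaves. *)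

Set Implicit Arguments.
Unset Strict Implicit.
Unset Printing Implicit Defensive.

(** * Alternating paths as orbits of a product of two involutions *)

Section AlternatingOrbit.

Variables (T : finType) (f g : T -> T).
Hypotheses (fK : involutive f) (gK : involutive g).

Let r := g \o f.

Lemma alternating_inj : injective r.
Proof. by apply: inj_comp; apply: inv_inj. Qed.

(** Conjugation by [g] inverts [r], so the two powers cancel. *)
Lemma iter_alternating_conj n x : iter n r (g (iter n r x)) = g x.
Proof.
elim: n x => [|n IHn] x //.
by rewrite iterSr iterS -[RHS](IHn x) {2 3}/r /= gK fK.
Qed.

Variable v : T.
Hypothesis gv : g v = v.

(** As [g] fixes [v], it sends [r^n v] to [r^(-n) v], which stays in the orbit because [r] is a
    permutation. *)
Lemma orbit_closed_g x : fconnect r v x -> fconnect r v (g x).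
Proof.
move=> /iter_findex <-; move: (findex r v x) => n.
rewrite (fconnect_sym alternating_inj).
have := fconnect_iter r n (g (iter n r v)).
by rewrite iter_alternating_conj gv.
Qed.

Lemma orbit_closed_f x : fconnect r v x -> fconnect r v (f x).
Proof.
move=> /orbit_closed_g /connect_trans; apply.
by rewrite (fconnect_sym alternating_inj) -{2}(fK x) fconnect1.
Qed.

(* With [x = r^i v] and [y = r^j v], being fixed by [f] means
   [r^(2i+1) v = v = r^(2j+1) v]; now [(2i+1) j - (2j+1) i = j - i]. *)
Lemma orbit_f_fixed_uniq x y :
  fconnect r v x -> fconnect r v y -> f x = x -> f y = y -> x = y.
Proof.
have period n : f (iter n r v) = iter n r v -> iter n.*2.+1 r v = v.
  move=> /(congr1 g) rx; rewrite -addnn -addnS iterD iterS.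
  by rewrite [r (iter n r v)]rx iter_alternating_conj.
have periodM n k : iter n r v = v -> iter (k * n) r v = v.
  by move=> h; elim: k => // k IHk; rewrite mulSn iterD IHk.
move=> /iter_findex <- /iter_findex <-.
move: (findex _ _ _) (findex _ _ _) => j i /period fi /period fj.
have := etrans (periodM _ i fj) (esym (periodM _ j fi)).
have -> : j * i.*2.+1 = (i * j).*2 + j by lia.
have -> : i * j.*2.+1 = (i * j).*2 + i by lia.
rewrite !iterD => eqij.
have inj_iter n : injective (iter n r).
  by elim: n => // n IHn a b /= /alternating_inj /IHn.
exact: inj_iter eqij.
Qed.

End AlternatingOrbit.

(** * Matchings as involutions, and arc counts *)

Section InvolutiveMatchings.

Variable T : finType.
Implicit Types (e : rel T) (f g : {ffun T -> T}).

(* A matching is encoded as the involution exchanging the ends of its edges;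
   its fixed points are the missed vertices. *)
Definition inv_matching e f :=
  [forall x, (f (f x) == x) && ((f x == x) || e x (f x))].

Definition covered f := [set x | f x != x].

Definition max_inv_matching e f :=
  inv_matching e f && [forall g, inv_matching e g ==> (#|covered g| <= #|covered f|)].

Definition arcs e := [set p : T * T | e p.1 p.2].

Definition nbrs e x := [set y | e x y].

(** The vertex [v] stays in [T] as an isolated point, so the induction never changes the type. *)
Definition del_vertex e v : rel T := fun x y => [&& e x y, x != v & y != v].

Lemma inv_matchingP e f :
  reflect (involutive f /\ forall x, f x != x -> e x (f x)) (inv_matching e f).
Proof.
apply: (iffP forallP) => [h | [fK fe] x].
  split=> x; have /andP[/eqP fx] := h x => //.
  by move=> /orP[->|->].
by rewrite fK eqxx /=; have [//|/fe] := eqVneq (f x) x.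
Qed.

Lemma max_inv_matchingP e f :
  reflect (inv_matching e f /\
           forall g, inv_matching e g -> #|covered g| <= #|covered f|)
          (max_inv_matching e f).
Proof.
apply: (iffP andP) => -[fm h]; split=> //.
  by move=> g gm; have /implyP := forallP h g; apply.
by apply/forallP => g; apply/implyP/h.
Qed.

Lemma exists_max_inv_matching e : exists f, max_inv_matching e f.
Proof.
pose idm := [ffun x : T => x].
have idP : inv_matching e idm by apply/forallP=> x; rewrite !ffunE eqxx.
case: (arg_maxnP (fun f => #|covered f|) idP) => f fm fmax.
by exists f; apply/max_inv_matchingP.
Qed.

Definition matched_pairs f := [set [set x; f x] | x in covered f].

Lemma covered_matching e f x :
  inv_matching e f -> (f x \in covered f) = (x \in covered f).
Proof.
by move=> /inv_matchingP[fK _]; rewrite !inE fK eq_sym.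
Qed.

Lemma matched_pairs_partition e f :
  inv_matching e f -> partition (matched_pairs f) (covered f).
Proof.
move=> fm; have [fK _] := inv_matchingP _ _ fm.
apply/and3P; split.
- rewrite eqEsubset; apply/andP; split; apply/subsetP => x.
    case/bigcupP=> E /imsetP[y yc ->]; rewrite !inE => /orP[]/eqP->.
      by move: yc; rewrite inE.
    by move: yc; rewrite -(covered_matching _ fm) inE.
  move=> xc; apply/bigcupP; exists [set x; f x]; first exact: imset_f.
  by rewrite !inE eqxx.
- apply/trivIsetP => _ _ /imsetP[x _ ->] /imsetP[y _ ->].
  apply: contraNT => /pred0Pn[z] /=; rewrite !inE.
  case/andP=> /orP[]/eqP-> /orP[]/eqP // h; last 1 first.
  + by rewrite (inv_inj fK h).
  + by rewrite h.
  + by rewrite h fK setUC.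
  + by rewrite -h fK setUC.
- apply/negP => /imsetP[x _ /setP/(_ x)].
  by rewrite !inE eqxx.
Qed.

Lemma card_covered e f :
  inv_matching e f -> #|covered f| = (#|matched_pairs f|).*2.
Proof.
move=> fm; rewrite -muln2.
apply: card_uniform_partition (matched_pairs_partition fm).
by move=> _ /imsetP[x xc ->]; rewrite cards2 eq_sym; move: xc; rewrite inE => ->.
Qed.

Lemma card_arcs e : #|arcs e| = \sum_x #|nbrs e x|.
Proof.
rewrite -sum1_card (eq_bigl (fun p => xpredT p.1 && e p.1 p.2)); last first.
  by move=> p; rewrite inE.
rewrite -(pair_big_dep xpredT e (fun _ _ => 1)) /=.
apply: eq_bigr => x _; rewrite -sum1_card.
by apply: eq_bigl => y; rewrite inE.
Qed.

Lemma card_arcs_del_vertex e v : symmetric e ->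
  #|arcs e| <= #|arcs (del_vertex e v)| + (#|nbrs e v|).*2.
Proof.
move=> esym.
set A := setX [set v] (nbrs e v); set B := setX (nbrs e v) [set v].
have sub : arcs e \subset arcs (del_vertex e v) :|: (A :|: B).
  apply/subsetP=> -[x y]; rewrite !inE /del_vertex /= => exy.
  rewrite exy /=; case: (eqVneq x v) => [<-|_] /=; first by rewrite exy.
  by case: (eqVneq y v) => [<-|_] //=; rewrite esym exy ?orbT.
apply: leq_trans (subset_leq_card sub) _.
apply: leq_trans (leq_card_setU _ _) _; rewrite leq_add2l.
apply: leq_trans (leq_card_setU _ _) _.
by rewrite !cardsX cards1 mul1n muln1 addnn.
Qed.

(** * Gallai's relation and the case where every vertex is missable *)

Section Missed.

Variable e : rel T.
Hypothesis esym : symmetric e.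
Hypothesis eirr : irreflexive e.

(** Concluding [x = y] instead of falsity makes the relation reflexive. *)
Definition not_both_missed x y :=
  forall f, max_inv_matching e f -> f x = x -> f y = y -> x = y.

Lemma not_both_missed_sym x y : not_both_missed x y -> not_both_missed y x.
Proof. by move=> h f fm fy fx; rewrite (h f fm fx fy). Qed.

(** Otherwise the edge could be added to [f], giving the larger matching [g]. *)
Lemma adj_not_both_missed x y : e x y -> not_both_missed x y.
Proof.
move=> exy f /max_inv_matchingP[fm fmax] fx fy.
have [//|xy] := eqVneq x y.
have [fK fe] := inv_matchingP _ _ fm.
pose g := [ffun z => if z == x then y else if z == y then x else f z].
have fxN z : z != x -> f z != x by apply: contra => /eqP h; rewrite -fx -h fK.
have fyN z : z != y -> f z != y by apply: contra => /eqP h; rewrite -fy -h fK.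
have gm : inv_matching e g.
  apply/inv_matchingP; split=> z; rewrite !ffunE.
    case: (eqVneq z x) => [->|zx]; first by rewrite eq_sym (negPf xy) eqxx.
    case: (eqVneq z y) => [->|zy]; first by rewrite eqxx.
    by rewrite (negPf (fxN _ zx)) (negPf (fyN _ zy)) fK.
  case: (eqVneq z x) => [->|zx] //.
  case: (eqVneq z y) => [->|zy]; first by rewrite esym.
  exact: fe.
have := fmax g gm; rewrite leqNgt => /negP[].
apply: proper_card; apply/properP; split.
  apply/subsetP => z; rewrite !inE ffunE => fz.
  case: (eqVneq z x) fz => [->|zx]; first by rewrite fx eqxx.
  by case: (eqVneq z y) => [->|zy]; first by rewrite fy eqxx.
by exists x; rewrite !inE ?ffunE ?eqxx ?fx ?eqxx // eq_sym.
Qed.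

(** For [O] closed under [f] and [g], this exchanges the two matchings along whole alternating
    components. *)
Definition splice (O : {pred T}) f g := [ffun x => if x \in O then f x else g x].

Lemma splice_inv_matching (O : {pred T}) f g :
  inv_matching e f -> inv_matching e g ->
  {in O, forall x, f x \in O} -> {in O, forall x, g x \in O} ->
  inv_matching e (splice O f g).
Proof.
move=> /inv_matchingP[fK fe] /inv_matchingP[gK ge] fO gO.
apply/inv_matchingP; split=> x; rewrite !ffunE.
  have [xO|xO] := boolP (x \in O); first by rewrite fO // fK.
  by rewrite (negPf (contra (gO (g x)) _)) gK.
by case: ifP => _; [apply: fe | apply: ge].
Qed.

Lemma card_covered_splice (O : {pred T}) f g :
  #|covered (splice O f g)| + #|covered (splice O g f)| = #|covered f| + #|covered g|.
Proof.
rewrite -!sum1dep_card.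
rewrite big_mkcond [X in _ + X]big_mkcond [in RHS]big_mkcond.
rewrite [X in _ = _ + X]big_mkcond -!big_split /=.
apply: eq_bigr => x _; rewrite !ffunE.
by case: (x \in O); rewrite // addnC.
Qed.

Hypothesis missable : forall x, exists2 f, max_inv_matching e f & f x = x.

(** Let [f] miss [x] and [z], and [g] miss [y]. The alternating path from [y] contains at most one
    vertex missed by [f]; exchanging along it frees [y] and keeps [x] or [z] missed, against one of
    the two assumptions. *)
Lemma not_both_missed_trans y x z :
  not_both_missed x y -> not_both_missed y z -> not_both_missed x z.
Proof.
move=> xy yz f fmax fx fz.
have [//|xz] := eqVneq x z.
have [g gmax gy] := missable y.
have [fm fM] := max_inv_matchingP _ _ fmax.
have [gm gM] := max_inv_matchingP _ _ gmax.
have [fK _] := inv_matchingP _ _ fm; have [gK _] := inv_matchingP _ _ gm.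
pose O : {pred T} := fconnect (g \o f) y.
have fO : {in O, forall t, f t \in O} by move=> t; apply: orbit_closed_f.
have gO : {in O, forall t, g t \in O} by move=> t; apply: orbit_closed_g.
have hm := splice_inv_matching gm fm gO fO.
have hm' := splice_inv_matching fm gm fO gO.
(* The opposite splice covers at most as much as [f], so this one covers at least as much as [g]. *)
have hmax : max_inv_matching e (splice O g f).
  apply/max_inv_matchingP; split=> // k /gM.
  have := card_covered_splice O f g; have := fM _ hm'; lia.
have yO : y \in O by apply: connect0.
have hy : splice O g f y = y by rewrite ffunE yO.
have [xO|xO] := boolP (x \in O); last first.
  have hx : splice O g f x = x by rewrite ffunE (negPf xO).
  by have yx := xy _ hmax hx hy; case/negP: xO; rewrite yx.
have zO : z \notin O.
  by apply: contra xz => zO; apply/eqP; apply: (orbit_f_fixed_uniq fK gK gy xO zO).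
have hz : splice O g f z = z by rewrite ffunE (negPf zO).
by have zy := yz _ hmax hy hz; case/negP: zO; rewrite -zy.
Qed.

Hypothesis tfree : forall x y z, ~ [/\ e x y, e y z & e x z].

Lemma card_arcs_missable m :
  (forall f, inv_matching e f -> #|covered f| <= m.*2) ->
  #|arcs e| <= m.+1 * m.*2.
Proof.
move=> cov_le.
have [f fmax] := exists_max_inv_matching e.
have [fm _] := max_inv_matchingP _ _ fmax.
have [fK fe] := inv_matchingP _ _ fm.
set C := covered f; have leC : #|C| <= m.*2 by apply: cov_le.
have missed t : t \notin C -> f t = t by rewrite inE negbK => /eqP.
(* Arcs leaving a missed vertex are charged to their covered end, so [a] summed over [C] counts all
   arcs. *)
pose b x := #|nbrs e x :\: C|; pose a x := #|nbrs e x| + b x.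
have aE : #|arcs e| = \sum_(x in C) a x.
  rewrite card_arcs (bigID (mem C)) /= big_split /=; congr (_ + _).
  have -> : \sum_(x | x \notin C) #|nbrs e x|
          = \sum_(x | x \notin C) \sum_(y in C) e x y.
    apply: eq_bigr => x xC; rewrite -sum1_card big_mkcond [RHS]big_mkcond.
    apply: eq_bigr => y _; rewrite [y \in nbrs _ _]inE.
    have [exy|] := boolP (e x y); last by case: ifP.
    have [//|yC] := boolP (y \in C).
    have xy := adj_not_both_missed exy fmax (missed _ xC) (missed _ yC).
    by rewrite xy eirr in exy.
  rewrite exchange_big; apply: eq_bigr => y _ /=.
  rewrite /b -sum1_card big_mkcond [RHS]big_mkcond; apply: eq_bigr => x _.
  by rewrite in_setD [x \in nbrs _ _]inE esym; case: (x \in C); case: (e y x).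
have pairle x : x \in C -> a x + a (f x) <= (m.+1).*2.
  rewrite inE => /fe exy; set y := f x in exy *.
  set U := nbrs e x :|: nbrs e y.
  have dis : nbrs e x :&: nbrs e y = set0.
    apply/setP=> z; rewrite !inE; apply/negP => /andP[exz eyz].
    by apply: (tfree (x := x) (y := y) (z := z)).
  have cU : #|U| = #|nbrs e x| + #|nbrs e y| by rewrite cardsU dis cards0 subn0.
  have cUD : #|U :\: C| = b x + b y.
    by rewrite setDUl cardsU -setDIl dis set0D cards0 subn0.
  (* Neighbours of [y] are related to [x] through [y]; hence any two missed vertices of [U] are
     related, and so equal. *)
  have xU z : z \in U -> not_both_missed x z.
    rewrite !inE => /orP[/adj_not_both_missed//|/adj_not_both_missed].
    exact/not_both_missed_trans/adj_not_both_missed.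
  have U1 : #|U :\: C| <= 1.
    apply/card_le1P => s; rewrite in_setD => /andP[sC sU] t.
    rewrite in_setD [t \in pred1 _]inE; apply/andP/eqP => [[tC tU]|-> //].
    apply: (not_both_missed_trans (not_both_missed_sym (xU t tU)) (xU s sU) fmax);
      exact: missed.
  have UC : #|U :&: C| <= m.*2 by apply: leq_trans leC; rewrite subset_leq_card ?subsetIr.
  (* The degrees sum to [#|U :&: C| + #|U :\: C|] and the [b] terms add [#|U :\: C|] again: at most
     [m.*2 + 2]. *)
  have := cardsID C U; rewrite /a; lia.
have refl : \sum_(x in C) a x = \sum_(x in C) a (f x).
  rewrite (reindex_inj (inv_inj fK)) /=.
  by apply: eq_bigl => x; rewrite (covered_matching _ fm).
have : \sum_(x in C) a x + \sum_(x in C) a (f x) <= #|C| * (m.+1).*2.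
  by rewrite -big_split -sum_nat_const; apply: leq_sum.
rewrite -refl -aE; nia.
Qed.

End Missed.

Lemma card_arcs_bound d m e : symmetric e -> irreflexive e ->
    (forall x y z, ~ [/\ e x y, e y z & e x z]) ->
    (forall x, #|nbrs e x| <= d) ->
    (forall f, inv_matching e f -> #|covered f| <= m.*2) ->
  m < d -> #|arcs e| <= d * m.*2.
Proof.
elim: m e => [|m IHm] e esym eirr tfree deg cov md.
  (* By [m < d], the factor [m.+1] of [card_arcs_missable] is at most [d]. With nothing coverable,
     every vertex is missable. *)
  apply: leq_trans (leq_mul md (leqnn _)).
  apply: card_arcs_missable => // x.
  have [f fmax] := exists_max_inv_matching e; exists f => //.
  have [/cov] := max_inv_matchingP _ _ fmax; rewrite leqn0 cards_eq0.
  by move=> /eqP/setP/(_ x); rewrite !inE => /negbFE/eqP.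
have [/existsP[v /forallP vcov]|/existsPn missable] :=
  boolP [exists v, forall f : {ffun T -> T}, max_inv_matching e f ==> (f v != v)].
  have sub x y : del_vertex e v x y -> e x y by case/and3P.
  have : #|arcs (del_vertex e v)| <= d * m.*2.
    apply: IHm => [x y|x|x y z [/sub xy /sub yz /sub xz]|x|f fm|].
    - by rewrite /del_vertex esym; congr (_ && _); rewrite andbC.
    - by rewrite /del_vertex eirr.
    - exact: (tfree x y z).
    - by apply: leq_trans (deg x); apply/subset_leq_card/subsetP=> y; rewrite !inE => /sub.
    - have [fK fe] := inv_matchingP _ _ fm.
      have fm' : inv_matching e f by apply/inv_matchingP; split=> // x /fe/sub.
      have fv : f v = v by apply/eqP/negbNE/negP => /fe; rewrite /del_vertex eqxx andbF.
      have [g gmax] := exists_max_inv_matching e.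
      have [gm gM] := max_inv_matchingP _ _ gmax.
      (* Since [f] misses [v], it is not maximum for [e]; covered sets have even size, so it covers
         at least two vertices fewer than [g]. *)
      have fg : #|covered f| < #|covered g|.
        rewrite ltnNge; apply/negP => gf.
        have := vcov f; rewrite fv eqxx implybF => /negP[].
        by apply/max_inv_matchingP; split=> // k /gM /leq_trans; apply.
      have := cov g gm; move: fg; rewrite (card_covered fm) (card_covered gm); lia.
    - exact: ltnW.
  have := card_arcs_del_vertex v esym; have := deg v; nia.
apply: leq_trans (leq_mul md (leqnn _)).
apply: card_arcs_missable => // x.
have /forallPn[f] := missable x; rewrite negb_imply negbK => /andP[fm /eqP fx].
by exists f.
Qed.

End InvolutiveMatchings.

(** * Transfer to edge sets and the matching number *)

Lemma card_edges_le (G : sgraph) : (#|edges G|).*2 <= #|arcs (@adj G)|.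
Proof.
rewrite -[leqRHS]sum1_card.
rewrite (partition_big (fun p => [set p.1; p.2]) (mem (edges G))) /=; last first.
  by move=> p; rewrite inE => ep; apply: imset_f.
rewrite -muln2 -sum_nat_const; apply: leq_sum => _ /imsetP[[x y] exy ->] /=.
rewrite inE /= in exy.
have xy : x != y by apply: contraTneq exy => ->; rewrite adj_irrefl.
(* The fibre over an edge contains both of its orientations, distinct by irreflexivity. *)
rewrite (bigD1 (x, y)) ?inE /= ?exy ?eqxx //=.
rewrite (bigD1 (y, x)) ?inE /= ?(adj_sym y x) ?exy ?(setUC [set y]) ?eqxx ?xpair_eqE //=.
by rewrite eq_sym (negPf xy).
Qed.

Lemma card_covered_matching_number (G : sgraph) (f : {ffun vertex G -> vertex G}) :
  inv_matching (@adj G) f -> #|covered f| <= (matching_number G).*2.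
Proof.
move=> fm; rewrite (card_covered fm) leq_double.
apply: (bigmax_sup (matched_pairs f)) => //.
have /and3P[_ triv _] := matched_pairs_partition fm.
rewrite /matching triv andbT; apply/subsetP => _ /imsetP[x xc ->].
have [_ fe] := inv_matchingP _ _ fm.
apply/imsetP; exists (x, f x) => //=.
by rewrite inE /=; apply: fe; rewrite inE in xc.
Qed.

Lemma triangle_free_edges_bound (G : sgraph) d m :
    triangle_free G -> max_degree G <= d -> matching_number G <= m -> m < d ->
  #|edges G| <= d * m.
Proof.
move=> tfree deg num md; rewrite -leq_double.
apply: leq_trans (card_edges_le G) _; rewrite doubleMr.
apply: card_arcs_bound md => //; first exact: adj_sym; first exact: adj_irrefl.
  by move=> x; apply: leq_trans deg; apply: (leq_bigmax x).
move=> f /card_covered_matching_number /leq_trans; apply.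
by rewrite leq_double.
Qed.

(** * The extremal graph: disjoint stars *)

Section Stars.

Variables m d : nat.

(* [(i, None)] is the centre of the [i]-th star. *)
Definition stars_adj : rel ('I_m * option 'I_d) :=
  fun x y => (x.1 == y.1) && (isSome x.2 != isSome y.2).

Lemma stars_adj_sym : symmetric stars_adj.
Proof. by move=> x y; rewrite /stars_adj eq_sym [in X in _ && X]eq_sym. Qed.

Lemma stars_adj_irrefl : irreflexive stars_adj.
Proof. by move=> x; rewrite /stars_adj !eqxx. Qed.

Definition stars := SGraph stars_adj_sym stars_adj_irrefl.

(** [isSome] of the second component is a proper 2-colouring. *)
Lemma stars_triangle_free : triangle_free stars.
Proof.
move=> x y z [] /=; rewrite /stars_adj => /andP[_ +] /andP[_ +] /andP[_].
by case: (isSome x.2); case: (isSome y.2); case: (isSome z.2).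
Qed.

Lemma stars_max_degree : 0 < d -> max_degree stars <= d.
Proof.
move=> d_gt0; apply/bigmax_leqP => -[i a] _; rewrite /degree.
case: a => [k|].
  apply: leq_trans d_gt0; rewrite -(cards1 ((i, None) : vertex stars)).
  apply/subset_leq_card/subsetP => -[j [l|]]; rewrite !inE /= /stars_adj /= ?andbF //.
  by rewrite andbT => /eqP->.
have sub : [set y : vertex stars | @adj stars (i, None) y]
    \subset (fun k => (i, Some k) : vertex stars) @: [set: 'I_d].
  apply/subsetP => -[j [l|]]; rewrite !inE /= /stars_adj /= ?andbF // andbT.
  by move=> /eqP->; apply: imset_f.
apply: leq_trans (subset_leq_card sub) _.
by rewrite -[leqRHS]card_ord -cardsT; apply: leq_imset_card.
Qed.

(** Every edge contains the centre of its star, so disjoint edges have different centres. *)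
Lemma stars_matching_number : 0 < m -> matching_number stars <= m.
Proof.
move=> m_gt0; apply/bigmax_leqP => M /andP[/subsetP ME triv].
(* The default [Ordinal m_gt0] is never reached on edges. *)
pose centre (E : {set vertex stars}) : 'I_m :=
  odflt (Ordinal m_gt0) [pick i | (i, None) \in E].
have centreP E : E \in M -> (centre E, None) \in E.
  move=> /ME /imsetP[[[i a] [j b]]]; rewrite inE /= => /andP[/= ij ab] EE.
  rewrite /centre; case: pickP => //= none; move: (none i) (none j).
  by rewrite EE !inE !xpair_eqE !eqxx; case: a b ab {EE} => [?|] [?|]; rewrite ?orbT.
rewrite -[leqRHS]card_ord.
have /card_in_imset <- : {in M &, injective centre}; last exact: max_card.
move=> E F EM FM EF; apply/eqP/negbNE/negP => neq.
have /pred0P/(_ (centre E, None)) := trivIsetP triv _ _ EM FM neq.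
by rewrite /= centreP // EF centreP.
Qed.

(** An edge is determined by its star and its leaf. *)
Lemma card_edges_stars : #|edges stars| = d * m.
Proof.
pose edge (p : 'I_m * 'I_d) : {set vertex stars} := [set (p.1, None); (p.1, Some p.2)].
have edge_inj : injective edge.
  move=> [i k] [j l] /setP /(_ (i, Some k)).
  by rewrite !inE !xpair_eqE !eqxx /= andbF /= => /esym/andP[/eqP-> /eqP[->]].
have -> : edges stars = edge @: [set: 'I_m * 'I_d].
  apply/setP => E; apply/imsetP/imsetP => [[[[i a] [j b]]]|[[i k] _ ->]].
    rewrite inE /= /stars_adj /= => /andP[/eqP<-].
    case: a b => [k|] [l|] // _ ->; first by exists (i, k); rewrite ?inE // setUC.
    by exists (i, l); rewrite ?inE.
  by exists ((i, None), (i, Some k)); rewrite // inE /= /stars_adj /= eqxx.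
by rewrite card_imset // cardsT card_prod !card_ord mulnC.
Qed.

End Stars.

Theorem theorem2 (d m : nat) (m_ge1 : 1 <= m) (m_lt_d : m < d) :
  f_triangle_eq d m (d * m).
Proof.
split=> [|j [G [tfree deg num <-]]]; last exact: triangle_free_edges_bound.
exists (stars m d); split.
- exact: stars_triangle_free.
- by apply: stars_max_degree; apply: leq_trans m_lt_d.
- exact: stars_matching_number.
- exact: card_edges_stars.
Qed.
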